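(* Every game satisfies $K\le 118$. If $K=118$, then $$f=8,\qquad P=96,\qquad C_{\mathrm p}=8,\qquad C+T=30.$$ In particular (when $K=118$), all sixteen pawns make six one-rank pawn moves, promoting on the sixth, and $C\ge 29$.
   Context: Game. Legal moves are those of standard chess (including the initial two-rank pawn advance, en passant, compulsory promotion, and castling, which counts as one move). One ply is one move by one player; White plays the odd-numbered plies. A game is a sequence of legal moves from the standard initial position, continued until the first mandatory termination condition of the FIDE Laws effective from 1 January 2023 applies; $L$ is its number of plies. The mandatory conditions are: (1) checkmate, stalemate, or a dead position (one from which neither player can checkmate by any possible sequence of legal moves); (2) fivefold repetition: the same position (same player to move, same kinds and colours of pieces on the same squares, same possible moves of all pieces of both players, so en passant availability and castling rights matter) has appeared at least five times; (3) the seventy-five-move rule: 150 consecutive plies without a pawn move or a capture (if the final ply delivers checkmate, checkmate takes precedence). Time forfeiture, resignation, draws by agreement and claimable draws are disregarded. Pieces. ''Piece'' includes pawns. The 32 initial pieces are followed through the game, retaining their identity after promotion; after promotion a piece is no longer a pawn, but it remains one of the pieces that began as pawns. ''All sixteen pawns'' are the sixteen pieces that began as pawns. A pawn move is a move of a piece while it is still a pawn (a promotion move is a pawn move). Kings are never captured. Segments. A critical move is a pawn move or a capture; every other move (including castling) is noncritical. Let $t_1<\dots<t_m$ be the plies on which critical moves occur. Set $T=1$ if at least one noncritical ply follows the last critical move, or if the game contains no critical move, and $T=0$ otherwise. Put $e_0=0$, $e_i=t_i$ for $1\le i\le m$ and, when $T=1$, $e_{m+1}=L$. The number of segments is $K=m+T$,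 segment $i$ being the set of plies $\{e_{i-1}+1,\dots,e_i\}$ ($1\le i\le K$). Counts. $P$ is the number of pawn moves in the game, $C$ the number of captures, and $C_{\mathrm p}$ the number of captures made by pawns (by a piece while still a pawn; a capture made on the promotion move counts). Origin pairs. For each file, the White pawn and the Black pawn that begin on that file form its origin pair. An origin pair is resolved if at least one of its members makes a capture while still a pawn (a capture on the promotion move counts; a capture made by the promoted piece on a later move does not), and unresolved otherwise. $f$ is the number of resolved origin pairs. *)

(* Defs.v *)
From HB Require Import structures.
From mathcomp Require Import all_boot.

Set Implicit Arguments.
Unset Strict Implicit.
Unset Printing Implicit Defensive.

Inductive color := White | Black.

Definition opponent (c : color) : color := if c is White then Black else White.

Definition bool_of_color (c : color) : bool := if c is White then true else false.
Definition color_of_bool (b : bool) : color := if b then White else Black.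
Lemma bool_of_colorK : cancel bool_of_color color_of_bool.
Proof. by case. Qed.
HB.instance Definition _ := Finite.copy color (can_type bool_of_colorK).

Inductive kind := Pawn | Knight | Bishop | Rook | Queen | King.

Definition ord_of_kind (k : kind) : 'I_6 :=
  match k with
  | Pawn => @Ordinal 6 0 isT
  | Knight => @Ordinal 6 1 isT
  | Bishop => @Ordinal 6 2 isT
  | Rook => @Ordinal 6 3 isT
  | Queen => @Ordinal 6 4 isT
  | King => @Ordinal 6 5 isT
  end.
Definition kind_of_ord (i : 'I_6) : kind :=
  nth Pawn [:: Pawn; Knight; Bishop; Rook; Queen; King] i.
Lemma ord_of_kindK : cancel ord_of_kind kind_of_ord.
Proof. by case. Qed.
HB.instance Definition _ := Finite.copy kind (can_type ord_of_kindK).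

Inductive wing := Kingside | Queenside.

Definition bool_of_wing (w : wing) : bool := if w is Kingside then true else false.
Definition wing_of_bool (b : bool) : wing := if b then Kingside else Queenside.
Lemma bool_of_wingK : cancel bool_of_wing wing_of_bool.
Proof. by case. Qed.
HB.instance Definition _ := Finite.copy wing (can_type bool_of_wingK).

(* (file, rank), both counted from 0: a1 is (0, 0), h8 is (7, 7). *)
Definition square := ('I_8 * 'I_8)%type.

Definition file (s : square) : 'I_8 := s.1.
Definition rank (s : square) : 'I_8 := s.2.

Definition i0 : 'I_8 := @Ordinal 8 0 isT.
Definition i1 : 'I_8 := @Ordinal 8 1 isT.
Definition i2 : 'I_8 := @Ordinal 8 2 isT.
Definition i3 : 'I_8 := @Ordinal 8 3 isT.
Definition i4 : 'I_8 := @Ordinal 8 4 isT.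
Definition i5 : 'I_8 := @Ordinal 8 5 isT.
Definition i6 : 'I_8 := @Ordinal 8 6 isT.
Definition i7 : 'I_8 := @Ordinal 8 7 isT.

(* Rank as seen by the player of colour c, from 0 to 7. *)
Definition rel_rank (c : color) (s : square) : nat :=
  if c is White then nat_of_ord (rank s) else 7 - rank s.

Definition dist (m n : nat) : nat := (m - n) + (n - m).
Definition dfile (s d : square) : nat := dist (file s) (file d).
Definition drank (s d : square) : nat := dist (rank s) (rank d).

(* x lies strictly between s and d: in the rectangle they span, and collinear
   with them. Inside the rectangle, unsigned differences decide collinearity. *)
Definition between (s x d : square) : bool :=
  (x != s) && (x != d)
  && (dfile s x + dfile x d == dfile s d)
  && (drank s x + drank x d == drank s d)
  && (dfile s x * drank s d == drank s x * dfile s d).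

(* A piece is identified throughout the game by its initial square, origin;
   promotion changes kind_of only. *)
Record piece := Piece { color_of : color; kind_of : kind; origin : square }.

Definition board := square -> option piece.

(* The passed square after a two-rank pawn advance is stored in ep_target,
   whether or not an en passant capture is possible. *)
Record position := Position {
  pieces : board;
  turn : color;
  castling_right : color -> wing -> bool;
  ep_target : option square }.

Definition clear (b : board) (s d : square) : bool :=
  [forall x, between s x d ==> ~~ isSome (b x)].

Definition straight (s d : square) : bool :=
  (s != d) && ((dfile s d == 0) || (drank s d == 0)).
Definition diagonal (s d : square) : bool :=
  (s != d) && (dfile s d == drank s d).

Definition attacks (b : board) (q : piece) (s d : square) : bool :=
  match kind_of q with
  | Pawn => (dfile s d == 1)
      && (rel_rank (color_of q) d == (rel_rank (color_of q) s).+1)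
  | Knight => ((dfile s d == 1) && (drank s d == 2))
      || ((dfile s d == 2) && (drank s d == 1))
  | Bishop => diagonal s d && clear b s d
  | Rook => straight s d && clear b s d
  | Queen => (straight s d || diagonal s d) && clear b s d
  | King => (s != d) && (dfile s d <= 1) && (drank s d <= 1)
  end.

Definition attacked_by (b : board) (c : color) (d : square) : bool :=
  [exists s, if b s is Some q then (color_of q == c) && attacks b q s d
             else false].

Definition holds (b : board) (s : square) (c : color) (k : kind) : bool :=
  if b s is Some q then (color_of q == c) && (kind_of q == k) else false.

Definition in_check (b : board) (c : color) : bool :=
  [exists s, holds b s c King && attacked_by b (opponent c) s].

(* (source, destination, promotion choice); castling is encoded as the
   two-file move of the king. *)
Definition move := (square * square * option kind)%type.

Definition src (m : move) : square := m.1.1.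
Definition dst (m : move) : square := m.1.2.
Definition promo (m : move) : option kind := m.2.

Definition mover (p : position) (m : move) : option piece := pieces p (src m).

Definition pawn_move (p : position) (m : move) : bool :=
  if mover p m is Some q then kind_of q == Pawn else false.

Definition en_passant (p : position) (m : move) : bool :=
  pawn_move p m && (dfile (src m) (dst m) == 1)
  && (ep_target p == Some (dst m)).

Definition ep_victim (m : move) : square := (file (dst m), rank (src m)).

Definition captured (p : position) (m : move) : option piece :=
  if en_passant p m then pieces p (ep_victim m) else pieces p (dst m).

Definition capture (p : position) (m : move) : bool := isSome (captured p m).

Definition home_rank (c : color) : 'I_8 := if c is White then i0 else i7.
Definition king_home (c : color) : square := (i4, home_rank c).
Definition rook_home (c : color) (w : wing) : square :=
  (if w is Kingside then i7 else i0, home_rank c).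
Definition king_castled (c : color) (w : wing) : square :=
  (if w is Kingside then i6 else i2, home_rank c).
Definition rook_castled (c : color) (w : wing) : square :=
  (if w is Kingside then i5 else i3, home_rank c).

Definition castling (p : position) (m : move) (w : wing) : bool :=
  holds (pieces p) (src m) (turn p) King
  && (src m == king_home (turn p)) && (dst m == king_castled (turn p) w).

(* The square crossed by the king is the one on which the rook lands. *)
Definition may_castle (p : position) (w : wing) : bool :=
  let b := pieces p in let c := turn p in
  castling_right p c w
  && holds b (king_home c) c King && holds b (rook_home c w) c Rook
  && clear b (king_home c) (rook_home c w)
  && ~~ attacked_by b (opponent c) (king_home c)
  && ~~ attacked_by b (opponent c) (rook_castled c w)
  && ~~ attacked_by b (opponent c) (king_castled c w).

Definition pawn_advance (b : board) (c : color) (s d : square) : bool :=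
  (file s == file d) && ~~ isSome (b d)
  && ((rel_rank c d == (rel_rank c s).+1)
      || ((rel_rank c s == 1) && (rel_rank c d == 3) && clear b s d)).

(* Piece movement, disregarding promotion and the safety of the own king. *)
Definition can_go (p : position) (q : piece) (m : move) : bool :=
  let b := pieces p in
  match kind_of q with
  | Pawn => pawn_advance b (color_of q) (src m) (dst m)
      || (attacks b q (src m) (dst m) && capture p m)
  | King => attacks b q (src m) (dst m)
      || (castling p m Kingside && may_castle p Kingside)
      || (castling p m Queenside && may_castle p Queenside)
  | _ => attacks b q (src m) (dst m)
  end.

Definition promotion_ok (q : piece) (m : move) : bool :=
  if (kind_of q == Pawn) && (rel_rank (color_of q) (dst m) == 7) then
    promo m \in [:: Some Knight; Some Bishop; Some Rook; Some Queen]
  else promo m == None.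

Definition target_ok (p : position) (m : move) : bool :=
  if pieces p (dst m) is Some q then
    (color_of q != turn p) && (kind_of q != King)
  else true.

Definition promote (k : option kind) (q : piece) : piece :=
  if k is Some k' then Piece (color_of q) k' (origin q) else q.

Definition hop_rook (b : board) (c : color) (w : wing) : board := fun x =>
  if x == rook_home c w then None
  else if x == rook_castled c w then b (rook_home c w)
  else b x.

Definition next_board (p : position) (m : move) : board := fun x =>
  if x == src m then None
  else if x == dst m then omap (promote (promo m)) (mover p m)
  else if en_passant p m && (x == ep_victim m) then None
  else if castling p m Kingside then hop_rook (pieces p) (turn p) Kingside x
  else if castling p m Queenside then hop_rook (pieces p) (turn p) Queenside x
  else pieces p x.

Definition legal (p : position) (m : move) : bool :=
  (if mover p m is Some q then
     (color_of q == turn p) && promotion_ok q m && target_ok p m && can_go p q m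
   else false)
  && ~~ in_check (next_board p m) (turn p).

Definition make_move (p : position) (m : move) : position := {|
  pieces := next_board p m;
  turn := opponent (turn p);
  castling_right := fun c w =>
    castling_right p c w && (src m != king_home c)
    && (src m != rook_home c w) && (dst m != rook_home c w);
  ep_target :=
    if pawn_move p m && (drank (src m) (dst m) == 2)
    then Some (file (src m), if turn p is White then i2 else i5)
    else None |}.

Fixpoint legal_line (p : position) (ms : seq move) : bool :=
  if ms is m :: ms' then legal p m && legal_line (make_move p m) ms' else true.

Definition play (p : position) (ms : seq move) : position := foldl make_move p ms.

Definition checkmate (p : position) : bool :=
  in_check (pieces p) (turn p) && [forall m, ~~ legal p m].

Definition stalemate (p : position) : bool :=
  ~~ in_check (pieces p) (turn p) && [forall m, ~~ legal p m].

Definition dead (p : position) : Prop :=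
  ~ exists ms : seq move, legal_line p ms /\ checkmate (play p ms).

Definition back_rank (i : 'I_8) : kind :=
  nth King [:: Rook; Knight; Bishop; Queen; King; Bishop; Knight; Rook] i.

Definition initial_board : board := fun s =>
  if rank s == i0 then Some (Piece White (back_rank (file s)) s)
  else if rank s == i1 then Some (Piece White Pawn s)
  else if rank s == i6 then Some (Piece Black Pawn s)
  else if rank s == i7 then Some (Piece Black (back_rank (file s)) s)
  else None.

Definition initial : position :=
  Position initial_board White (fun _ _ => true) None.

(* The position in which the possible moves of colour c are its legal moves;
   only the player on turn may capture en passant. *)
Definition as_turn (c : color) (p : position) : position :=
  if c == turn p then p else Position (pieces p) c (castling_right p) None.

(* Sameness for the repetition rule; the identity of pieces is irrelevant. *)
Definition appearance (q : piece) : color * kind := (color_of q, kind_of q).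

Definition same_position (p p' : position) : bool :=
  [&& turn p == turn p',
      [forall s, omap appearance (pieces p s) == omap appearance (pieces p' s)],
      [forall c, forall w, castling_right p c w == castling_right p' c w]
    & [forall c, forall m, legal (as_turn c p) m == legal (as_turn c p') m]].

(* A game record is its sequence of moves. A ply is given by the position
   before the move and the move; plies are numbered from 1. *)
Definition ply := (position * move)%type.

Fixpoint plies_from (p : position) (g : seq move) : seq ply :=
  if g is m :: g' then (p, m) :: plies_from (make_move p m) g' else [::].

Definition plies (g : seq move) : seq ply := plies_from initial g.

Definition position_after (g : seq move) (k : nat) : position :=
  play initial (take k g).

Definition critical (y : ply) : bool := pawn_move y.1 y.2 || capture y.1 y.2.

Definition critical_at (g : seq move) (t : nat) : bool :=
  nth false [seq critical y | y <- plies g] t.-1.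

Definition fivefold_repetition (g : seq move) (k : nat) : bool :=
  [exists i : 'I_k.+1, 5 <= #|[set j : 'I_k.+1 |
     same_position (position_after g i) (position_after g j)]|].

Definition seventy_five_moves (g : seq move) (k : nat) : bool :=
  (150 <= k) && all (fun t => ~~ critical_at g t) (iota (k - 149) 150).

(* A mandatory termination condition holds after k plies. The precedence of
   checkmate affects only the result of a game, not its length. *)
Definition terminated (g : seq move) (k : nat) : Prop :=
  let p := position_after g k in
  checkmate p \/ stalemate p \/ dead p
  \/ fivefold_repetition g k \/ seventy_five_moves g k.

Definition is_game (g : seq move) : Prop :=
  [/\ legal_line initial g,
      forall k, k < size g -> ~ terminated g k
    & terminated g (size g)].

(* The plies t_1 < ... < t_m. *)
Definition critical_plies (g : seq move) : seq nat :=
  [seq t <- iota 1 (size g) | critical_at g t].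

Definition has_tail (g : seq move) : bool :=
  let t := last 0 (critical_plies g) in
  (critical_plies g == [::])
  || has (fun u => ~~ critical_at g u) (iota t.+1 (size g - t)).

(* T, K, P, C and C_p, in this order, are the num_* below. *)
Definition num_tail (g : seq move) : nat := nat_of_bool (has_tail g).

Definition num_segments (g : seq move) : nat :=
  size (critical_plies g) + num_tail g.

Definition num_pawn_moves (g : seq move) : nat :=
  count (fun y => pawn_move y.1 y.2) (plies g).

Definition num_captures (g : seq move) : nat :=
  count (fun y => capture y.1 y.2) (plies g).

Definition pawn_capture (y : ply) : bool :=
  pawn_move y.1 y.2 && capture y.1 y.2.

Definition num_pawn_captures (g : seq move) : nat := count pawn_capture (plies g).

Definition pawn_home (c : color) (i : 'I_8) : square :=
  (i, if c is White then i1 else i6).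

Definition moved_by (o : square) (y : ply) : bool :=
  omap origin (mover y.1 y.2) == Some o.

(* The origin pair of file i; num_resolved is f. *)
Definition resolved (g : seq move) (i : 'I_8) : bool :=
  [exists c, has (fun y => moved_by (pawn_home c i) y && pawn_capture y) (plies g)].

Definition num_resolved (g : seq move) : nat := #|[set i | resolved g i]|.

Definition pawn_moves_of (g : seq move) (o : square) : seq ply :=
  [seq y <- plies g | moved_by o y && pawn_move y.1 y.2].

Definition one_rank (y : ply) : bool := drank (src y.2) (dst y.2) == 1.

Definition promotes (y : ply) : bool := isSome (promo y.2).

Definition six_steps_to_promotion (g : seq move) (o : square) : Prop :=
  let s := pawn_moves_of g o in
  [/\ size s = 6, all one_rank s
    & [seq promotes y | y <- s] = [:: false; false; false; false; false; true]].

(* Main.v *)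
Require Import Defs.
From mathcomp Require Import all_boot.
From mathcomp Require Import zify.

(** A ply is critical if it is a pawn move or a capture, so the number of
    critical plies is P + C - C_p, and K = P - C_p + (C + T). The two summands
    are bounded separately, by 88 and 30.

    Captures. Every capture takes a man off the board and kings survive, so
    C <= 30 ([captures_le30]). If C = 30 then only the kings are left. They can
    only check each other simultaneously, which no legal move allows, so the
    position is dead and the game stops at the thirtieth capture
    ([bare_kings_dead]); hence T = 0. So C + T <= 30 ([captures_tail_le30]).

    Pawn moves. The ranks that a pawn advances add up to at most 6, and each of
    its moves advances it by at least one rank, so an origin pair makes at most
    12 pawn moves. In an unresolved pair both pawns stay on their file as long
    as they are pawns, and neither can jump over the other. Hence they face each
    other until one of them leaves the board, and at that moment it has advanced
    by at most 4 ranks: the pair makes at most 10 pawn moves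
    ([pair_moves_bound]). This gives P <= 80 + 2 f. Each resolved pair accounts
    for a pawn capture, so f <= C_p, and P - C_p <= 80 + f <= 88.

    If K = 118, all these inequalities are equalities. In particular each pawn
    makes six moves of total advance at most 6, so each move is by one rank and
    the sixth, which completes the advance to the last rank, is the promotion
    ([six_moves_promote]).

    All the facts about the past of a position used here are collected in
    the record [history], which holds initially and is preserved by legal
    moves. *)

Set Implicit Arguments.
Unset Strict Implicit.
Unset Printing Implicit Defensive.

(** * Legal moves *)

Lemma holdsP b s c k :
  reflect (exists q, [/\ b s = Some q, color_of q = c & kind_of q = k])
          (holds b s c k).
Proof.
rewrite /holds; case: (b s) => [q|]; last by constructor=> -[q []].
apply: (iffP andP) => [[/eqP <- /eqP <-]|[q' [[<-] <- <-]]]; last by [].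
by exists q.
Qed.

Lemma legal_inv p m : legal p m -> exists q,
  [/\ mover p m = Some q, color_of q = turn p, promotion_ok q m,
      target_ok p m & can_go p q m].
Proof.
case/andP; case E: (mover p m) => [q|] // /andP[/andP[/andP[/eqP Hc Hp] Ht] Hg] _.
by exists q.
Qed.

Lemma castling_kind p m w q :
  castling p m w -> mover p m = Some q -> kind_of q = King.
Proof.
by move=> /andP[/andP[/holdsP[q' [E _ Hk]] _] _]; rewrite /mover E => -[<-].
Qed.

(** A king standing on its home square reaches a castling square by castling
    only, so the rules of castling may be assumed whenever the board changes
    according to it. *)
Lemma legal_castling p m w : legal p m -> castling p m w -> may_castle p w.
Proof.
move=> /legal_inv[q [Hq Hc _ _ Hg]] Hw.
have Hk := castling_kind Hw Hq.
move: Hg; rewrite /can_go /attacks Hk.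
case/andP: Hw => /andP[_ /eqP Hs] /eqP Hd.
rewrite /castling Hs Hd.
case/orP=> [/orP[|]|].
- rewrite /dfile /drank /dist; case: w {Hd} => /=; lia.
- by case/andP=> /andP[_ /eqP H]; case: w {Hd} H.
- by case/andP=> /andP[_ /eqP H]; case: w {Hd} H.
Qed.

Lemma castling_dst_empty p m w : legal p m -> castling p m w ->
  pieces p (dst m) = None /\ pieces p (rook_castled (turn p) w) = None.
Proof.
move=> Hl Hw; have := legal_castling Hl Hw.
case/andP: Hw => _ /eqP ->.
rewrite /may_castle; do 3 case/andP; case/andP=> _ /forallP Hcl _ _ _.
by split;
  [have:= Hcl (king_castled (turn p) w) | have:= Hcl (rook_castled (turn p) w)];
  case: (turn p); case: w {Hcl} => /=;
  case: (pieces p _).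
Qed.

Lemma legal_src_neq_dst p m : legal p m -> src m != dst m.
Proof.
move=> Hl; have [q [Hq _ _ _]] := legal_inv Hl; apply: contraTneq => E.
have castF w : castling p m w = false.
  apply/negP=> /andP[/andP[_ /eqP Hs] /eqP Hd].
  by move: Hd; rewrite -E Hs; case: (turn p); case: w.
rewrite /can_go /attacks /pawn_advance /straight /diagonal /dfile /drank /dist.
rewrite !castF -E !eqxx !subnn /= orbF.
case: (kind_of q) => //=.
rewrite orbF; case: (color_of q); rewrite /rel_rank negb_and; lia.
Qed.

(** A pawn move advances by its number of ranks, which is what makes the total
    advance of a pawn a function of its rank; promotion happens exactly on
    arrival at the last rank. *)
Lemma legal_pawn_move p m q : legal p m -> mover p m = Some q ->
  kind_of q = Pawn ->
  [/\ rel_rank (color_of q) (dst m)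
      = rel_rank (color_of q) (src m) + drank (src m) (dst m),
      0 < drank (src m) (dst m),
      isSome (promo m) = (rel_rank (color_of q) (dst m) == 7) &
      pawn_advance (pieces p) (color_of q) (src m) (dst m) \/ capture p m].
Proof.
move=> Hl Hq Hk; have [q' [Hq']] := legal_inv Hl.
move: Hq'; rewrite Hq => -[<-] _ Hp _.
rewrite /can_go Hk => Hg.
have [Hr Hr0] : rel_rank (color_of q) (dst m)
      = rel_rank (color_of q) (src m) + drank (src m) (dst m) /\
      0 < drank (src m) (dst m).
  move: Hg; rewrite /pawn_advance /attacks Hk /drank /dist /rel_rank.
  have := ltn_ord (rank (src m)); have := ltn_ord (rank (dst m)).
  case: (color_of q); lia.
split=> //.
- move: Hp; rewrite /promotion_ok Hk /=.
  by case: (_ == 7) => [|/eqP -> //]; rewrite !inE; case: (promo m).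
- by case/orP: Hg => [->|/andP[_ ->]]; [left|right].
Qed.

(** * The position invariant *)

(** Pawns can be followed by their origin because [pawn_unique] excludes two of
    them with the same one. The en passant clause guarantees that the man
    removed from a square other than the destination is a pawn, so that kings
    survive. *)
Record coherent (p : position) : Prop := Coherent {
  pawn_origin : forall s q, pieces p s = Some q -> kind_of q = Pawn ->
    origin q = pawn_home (color_of q) (file (origin q));
  pawn_unique : forall s s' q q', pieces p s = Some q -> pieces p s' = Some q' ->
    kind_of q = Pawn -> kind_of q' = Pawn -> origin q = origin q' -> s = s';
  king_alive : forall c, exists s, holds (pieces p) s c King;
  ep_pawn : forall t, ep_target p = Some t ->
    rank t = (if turn p is White then i5 else i2) /\
    exists c, holds (pieces p) (file t, if turn p is White then i4 else i3) c Pawn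
}.

(** Pawns appear on new squares only by their own moves: castling displaces no
    pawn, and promotion never yields one. *)
Lemma pawn_after p m s q : legal p m -> next_board p m s = Some q ->
  kind_of q = Pawn ->
  [/\ s = dst m, promo m = None & mover p m = Some q]
  \/ [/\ s != dst m, s != src m & pieces p s = Some q].
Proof.
move=> Hl; rewrite /next_board.
have [//|Hs] := eqVneq s (src m).
have [->|Hd] := eqVneq s (dst m).
  have [q0 [Hq0 _ Hp _ _]] := legal_inv Hl.
  rewrite Hq0 /= => -[<-].
  move: Hp; rewrite /promotion_ok /promote; case: (promo m) => [k|]; last by left.
  by case: ifP => // _; rewrite !inE => /or4P[] /eqP [->].
have hop w : castling p m w -> hop_rook (pieces p) (turn p) w s = Some q ->
    kind_of q = Pawn -> pieces p s = Some q.
  move=> Hc; rewrite /hop_rook; case: ifP => // _; case: ifP => // _ E Hk.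
  have := legal_castling Hl Hc; rewrite /may_castle.
  do 4 case/andP; case/andP=> _ /holdsP[q' []].
  by rewrite E => -[<-] _; rewrite Hk.
case: ifP => // _; case: ifP => [Hc E Hk|_]; first by right; split=> //; apply: hop E Hk.
case: ifP => [Hc E Hk|_ E _]; last by right.
by right; split=> //; apply: hop E Hk.
Qed.

(** The rank of the source of an en passant capture is determined by the target,
    so the man removed is the pawn that has just advanced. *)
Lemma en_passant_victim p m : coherent p -> legal p m -> en_passant p m ->
  exists c, holds (pieces p) (ep_victim m) c Pawn.
Proof.
move=> Hco Hl /andP[/andP[Hpm Hf] /eqP Hep].
have [Hr [c Hc]] := ep_pawn Hco Hep; exists c.
have [q [Hq Hcq _ _]] := legal_inv Hl.
move: Hpm; rewrite /pawn_move Hq => /eqP Hk.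
rewrite /can_go Hk /attacks Hk => Hg.
suff -> : ep_victim m = (file (dst m), if turn p is White then i4 else i3) by [].
congr pair; apply/val_inj => /=.
move: Hg Hr Hf; rewrite /pawn_advance /rel_rank Hcq /dfile /dist.
have := ltn_ord (rank (src m)).
case: (turn p) => ? Hg Hr; move: Hg; rewrite Hr /=; 
  case: (file _ =P file _) => [->|_] /=; lia.
Qed.

Lemma next_board_dst p m q : legal p m -> mover p m = Some q ->
  next_board p m (dst m) = Some (promote (promo m) q).
Proof.
move=> Hl Hq; rewrite /next_board eq_sym (negbTE (legal_src_neq_dst Hl)) eqxx.
by rewrite Hq.
Qed.

Lemma king_after p m c : coherent p -> legal p m ->
  exists s, holds (next_board p m) s c King.
Proof.
move=> Hco Hl; have [s Hs] := king_alive Hco c.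
have [q [Hq Hc Hp Ht Hg]] := legal_inv Hl.
have [Es|Ns] := eqVneq s (src m).
  (* The king moves; as it is not a pawn, it keeps its kind. *)
  exists (dst m); move/holdsP: Hs => [q' [E Hc' Hk']].
  move: E; rewrite Es -/(mover p m) Hq => -[E]; subst q'.
  apply/holdsP; exists q; split=> //; rewrite (next_board_dst Hl Hq).
  by move: Hp; rewrite /promotion_ok Hk' /= => /eqP ->.
(* The king stays: it is neither captured nor overwritten by a castling rook. *)
exists s; move: (Hs); rewrite /holds /next_board (negbTE Ns).
have /negbTE -> : s != dst m.
  apply: contraTneq Hs => ->; apply/holdsP=> -[q' [E _ Hk]].
  by move: Ht; rewrite /target_ok E Hk andbF.
case: ifP => [/andP[Hep /eqP Ev]|_].
  have [c' /holdsP[q' [E _ Hk]]] := en_passant_victim Hco Hl Hep.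
  by rewrite Ev E Hk andbF.
have hop w : castling p m w -> hop_rook (pieces p) (turn p) w s = pieces p s.
  move=> Hw; rewrite /hop_rook.
  have := legal_castling Hl Hw; rewrite /may_castle.
  do 4 case/andP; case/andP=> _ /holdsP[qr [Er _ Kr]] _ _ _ _.
  case: ifP => [/eqP E|_].
    by case/holdsP: Hs => q' [E']; move: E'; rewrite E Er => -[<-]; rewrite Kr.
  case: ifP => [/eqP E|//].
  by case/holdsP: Hs => q' [E']; move: E'; rewrite E (castling_dst_empty Hl Hw).2.
by case: ifP => [/hop ->|_]; last case: ifP => [/hop ->|_].
Qed.

Lemma back_rank_not_pawn i : back_rank i <> Pawn.
Proof. by case: i => n Hn; rewrite /back_rank /=; do 8?case: n Hn => [|n] Hn. Qed.

Lemma coherent_initial : coherent initial.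
Proof.
have pawnE s q : initial_board s = Some q -> kind_of q = Pawn ->
    origin q = s /\ s = pawn_home (color_of q) (file s).
  rewrite /initial_board; case: s => a b; rewrite /rank /file /=.
  have noP := @back_rank_not_pawn a.
  case: ifP => [_ [<-] //|_].
  case: ifP => [/eqP -> [<-] //|_].
  case: ifP => [/eqP -> [<-] //|_].
  by case: ifP => [_ [<-] //|_].
split.
- by move=> s q /pawnE H /H[-> {1}->].
- move=> s s' q q' /pawnE H /pawnE H' Hk Hk'.
  by have [-> _] := H Hk; have [-> _] := H' Hk'.
- by move=> c; exists (king_home c); case: c; rewrite /holds /= /initial_board.
- by [].
Qed.

Lemma coherent_make_move p m : coherent p -> legal p m ->
  coherent (make_move p m).
Proof.
move=> Hco Hl; split=> /=.
- move=> s q /(pawn_after Hl) H Hk.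
  by have [[_ _ Hq]|[_ _ Hq]] := H Hk; apply: pawn_origin Hq Hk.
- move=> s s' q q' /(pawn_after Hl) H /(pawn_after Hl) H' Hk Hk' Ho.
  have [[E _ Hq]|[N1 N2 Hq]] := H Hk; have [[E' _ Hq']|[N1' N2' Hq']] := H' Hk'.
  + by rewrite E E'.
  + by rewrite (pawn_unique Hco Hq' Hq Hk' Hk) ?eqxx // in N2'.
  + by rewrite (pawn_unique Hco Hq Hq' Hk Hk') ?eqxx // in N2.
  + exact: pawn_unique Hq Hq' Hk Hk' Ho.
- by move=> c; apply: king_after.
- move=> t; case: ifP => // /andP[Hpm /eqP H2] [<-].
  have [q [Hq Hcq _ _ Hg]] := legal_inv Hl.
  move: Hpm; rewrite /pawn_move Hq => /eqP Hk.
  have [Hr _ Hpr _] := legal_pawn_move Hl Hq Hk.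
  split; first by case: (turn p).
  exists (turn p); apply/holdsP; exists q; split=> //.
  have Hadv : pawn_advance (pieces p) (color_of q) (src m) (dst m).
    move: Hg; rewrite /can_go Hk => /orP[//|/andP[]].
    rewrite /attacks Hk => /andP[_]; rewrite Hr H2; lia.
  have Ed : (file (src m), if opponent (turn p) is White then i4 else i3) = dst m.
    move: Hadv => /andP[/andP[/eqP Hf _] Hor].
    rewrite [RHS]surjective_pairing -/(file _) -/(rank _) -Hf; congr pair.
    apply/val_inj; move: Hor Hr; rewrite H2 /rel_rank Hcq.
    have := ltn_ord (rank (dst m)).
    by case: (turn p) => /=; lia.
  rewrite /file /= -/(file _) Ed (next_board_dst Hl Hq).
  have : isSome (promo m) = false.
    rewrite Hpr; move: Hadv => /andP[_]; rewrite Hr H2; lia.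
  by case: (promo m).
Qed.

(** * Counting men *)

Definition occupied (p : position) : {set square} := [set x | isSome (pieces p x)].

(** A noncapturing move fills at most as many squares as it empties: one, or two
    when castling. A capture either fills none, or empties the square of the
    en passant victim as well. *)
Lemma occupied_make_move p m : coherent p -> legal p m ->
  #|occupied (make_move p m)| + capture p m <= #|occupied p|.
Proof.
move=> Hco Hl; have [q [Hq Hcq _ _ Hg]] := legal_inv Hl.
have Nsd := legal_src_neq_dst Hl.
have Hsrc : src m \in occupied p by rewrite inE -/(mover p m) Hq.
have card_src := cardsD1 (src m) (occupied p); rewrite Hsrc add1n in card_src.
have [w Hw | Hnc] := pickP (fun w => castling p m w).
  have := legal_castling Hl Hw; rewrite /may_castle.
  do 4 case/andP; case/andP=> _ /holdsP[qr [Er _ Kr]] _ _ _ _.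
  have [Ed _] := castling_dst_empty Hl Hw.
  have Kq := castling_kind Hw Hq.
  have -> : capture p m = false.
    by rewrite /capture /captured /en_passant /pawn_move Hq Kq Ed.
  have /andP[/andP[_ /eqP Es] _] := Hw.
  have Hr : rook_home (turn p) w \in occupied p :\ src m.
    by rewrite !inE Er Es andbT; case: (turn p); case: (w).
  have := cardsD1 (rook_home (turn p) w) (occupied p :\ src m); rewrite Hr.
  suff /subset_leq_card : occupied (make_move p m) \subset
      dst m |: (rook_castled (turn p) w |:
                occupied p :\ src m :\ rook_home (turn p) w).
    rewrite card_src !cardsU1 addn0 => H ->; apply: leq_trans H _.
    move: #|_ :\ rook_home _ _| => n.
    by do 2 case: (_ \notin _) => /=; lia.
  apply/subsetP=> x; rewrite !inE /= /next_board.
  case: (x =P src m) => //= _; case: (x =P dst m) => //= _.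
  rewrite /en_passant /pawn_move Hq Kq /=.
  have hop w' : castling p m w' -> isSome (hop_rook (pieces p) (turn p) w' x) ->
     [|| x == rook_castled (turn p) w
       | (x != rook_home (turn p) w) && isSome (pieces p x)].
    move=> Hw'; have -> : w' = w.
      move: Hw Hw' => /andP[_ /eqP Ew] /andP[_]; rewrite Ew.
      by case: (turn p); case: w'; case: (w).
    by rewrite /hop_rook; case: ifP => // _; case: ifP.
  case: ifP => [Hc|C1]; first exact: hop.
  case: ifP => [Hc|C2]; first exact: hop.
  by case: (w) Hw; rewrite ?C1 ?C2.
(* Without castling, only the destination can become occupied. *)
have step x : x != src m -> x != dst m -> isSome (next_board p m x) ->
    isSome (pieces p x) && ~~ (en_passant p m && (x == ep_victim m)).
  move=> /negbTE N1 /negbTE N2; rewrite /next_board N1 N2 !Hnc.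
  by case: ifP => // _; rewrite andbT.
case Hep : (en_passant p m).
  have [c /holdsP[v [Ev _ _]]] := en_passant_victim Hco Hl Hep.
  have Hv : ep_victim m \in occupied p :\ src m.
    rewrite !inE Ev andbT; apply/eqP=> Evs; case/andP: Hep => /andP[_].
    by rewrite -Evs /ep_victim /dfile /dist /= subnn.
  have := cardsD1 (ep_victim m) (occupied p :\ src m); rewrite Hv.
  suff /subset_leq_card : occupied (make_move p m) \subset
      dst m |: occupied p :\ src m :\ ep_victim m.
    rewrite card_src cardsU1 => H ->; move: H.
    move: #|occupied (make_move p m)| #|_ :\ ep_victim m| => n n'.
    by case: (_ \notin _); case: (capture p m) => /=; lia.
  apply/subsetP=> x; rewrite !inE /=.
  case: (x =P dst m) => //= /eqP Nd Hx.
  have Ns : x != src m by apply: contraTneq Hx => ->; rewrite /next_board eqxx.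
  by have := step x Ns Nd Hx; rewrite Hep Ns /= andbC.
have sub : occupied (make_move p m) \subset dst m |: occupied p :\ src m.
  apply/subsetP=> x; rewrite !inE /=.
  case: (x =P dst m) => //= /eqP Nd Hx.
  have Ns : x != src m by apply: contraTneq Hx => ->; rewrite /next_board eqxx.
  by have := step x Ns Nd Hx; rewrite Ns Hep => /andP[].
move: (subset_leq_card sub); rewrite cardsU1 !inE eq_sym Nsd /=.
rewrite card_src /capture /captured Hep.
move: #|occupied (make_move p m)| #|_ :\ src m| => n n'.
by case: (pieces p (dst m)) => [v|] /=; lia.
Qed.

Lemma card_occupied_initial : #|occupied initial| = 32.
Proof.
have -> : occupied initial = setX setT (i0 |: (i1 |: [set i6; i7])).
  apply/setP=> -[a b]; rewrite !inE /= /initial_board /rank /=.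
  by do 4 (case: ifP => //= _).
by rewrite cardsX cardsT card_ord !cardsU1 cards1 !inE.
Qed.

(** * The history of a pawn *)

Definition pawn_moves_in (l : seq ply) (o : square) : seq ply :=
  [seq y <- l | moved_by o y && pawn_move y.1 y.2].

Definition steps (l : seq ply) (o : square) : seq nat :=
  [seq drank (src y.2) (dst y.2) | y <- pawn_moves_in l o].

Definition advance l o := sumn (steps l o).

Definition pair_resolved (l : seq ply) (i : 'I_8) : bool :=
  [exists c, has (fun y => moved_by (pawn_home c i) y && pawn_capture y) l].

(** Stated as a property of single plies, so that counts over a list of plies
    can be split by origin without reference to positions. *)
Definition attributed (y : ply) : bool :=
  pawn_move y.1 y.2 ==> [exists c, exists i, moved_by (pawn_home c i) y].

(** Since the advance of a pawn determines its rank, two pawns of an origin pair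
    on their common file face each other exactly when their advances add up to
    at most 4, that is, when the sum of the ranks, each seen by its own player,
    is at most 6. The second alternative of [unresolved_pair] takes over when
    one of them has left the board as a pawn: it never returns, so its advance
    stays at most 4, whatever the other one does. [promotes_at6] identifies
    promotions by the partial sums of the steps, so that the steps alone decide
    which move promotes. *)
Record history (l : seq ply) (p : position) : Prop := History {
  now_coherent : coherent p;
  pawn_rank : forall s q, pieces p s = Some q -> kind_of q = Pawn ->
    (advance l (origin q)).+1 = rel_rank (color_of q) s /\
    rel_rank (color_of q) s <= 6;
  advance_le6 : forall o, advance l o <= 6;
  steps_gt0 : forall o, all (leq 1) (steps l o);
  promotes_at6 : forall o, [seq promotes y | y <- pawn_moves_in l o]
    = [seq d == 6 | d <- scanl addn 0 (steps l o)];
  unresolved_file : forall s q, pieces p s = Some q -> kind_of q = Pawn ->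
    ~~ pair_resolved l (file (origin q)) -> file s = file (origin q);
  unresolved_pair : forall i, ~~ pair_resolved l i ->
    advance l (pawn_home White i) + advance l (pawn_home Black i) <= 4 \/
    exists c, advance l (pawn_home c i) <= 4 /\
      forall s q, pieces p s = Some q -> kind_of q = Pawn ->
        origin q <> pawn_home c i;
  all_attributed : all attributed l;
  men_left : #|occupied p| + count (fun y => capture y.1 y.2) l <= 32;
  last_mover_safe : l <> [::] -> ~~ in_check (pieces p) (opponent (turn p))
}.

Lemma history_initial : history [::] initial.
Proof.
split=> //.
- exact: coherent_initial.
- move=> s q /=; rewrite /initial_board /advance /=.
  case: s => a b; rewrite /rank /file /rel_rank /=.
  have noP := @back_rank_not_pawn a.
  case: ifP => [_ [<-] //|_].
  case: ifP => [/eqP -> [<-] //|_].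
  case: ifP => [/eqP -> [<-] //|_].
  by case: ifP => [_ [<-] //|_].
- move=> s q /= E Hk _; move: E Hk; rewrite /initial_board.
  case: s => a b; rewrite /rank /file /=.
  by do 4 (case: ifP => [_ [<-] //|_]).
- by move=> i _; left.
- by rewrite card_occupied_initial.
Qed.

Lemma opponentK : involutive opponent.
Proof. by case. Qed.

Lemma pawn_home_inj c c' i i' :
  pawn_home c i = pawn_home c' i' -> c = c' /\ i = i'.
Proof. by case: c; case: c' => // -[]. Qed.

(** Two opposing pawns on one file that face each other still do so after a
    noncapturing move of either. *)
Lemma facing_pawns p m q s : legal p m -> mover p m = Some q ->
  kind_of q = Pawn -> ~~ capture p m -> isSome (pieces p s) ->
  file s = file (src m) ->
  rel_rank (color_of q) (src m) + rel_rank (opponent (color_of q)) s <= 6 ->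
  rel_rank (color_of q) (dst m) + rel_rank (opponent (color_of q)) s <= 6.
Proof.
move=> Hl Hq Hk /negP Hcap Hs Hf Hle.
have [_ _ _ [|//]] := legal_pawn_move Hl Hq Hk.
move=> /andP[/andP[/eqP Hfd Hd] Hadv].
have Nd : s != dst m by apply: contraNneq Hd => <-.
have Nr : nat_of_ord (rank s) <> rank (dst m).
  move=> /val_inj E; move/eqP: Nd; apply.
  rewrite [s]surjective_pairing [dst m]surjective_pairing; congr pair => //.
  by rewrite -!/(file _) -Hfd -Hf.
have rsrc := ltn_ord (rank (src m)); have rdst := ltn_ord (rank (dst m)).
have rs := ltn_ord (rank s).
(* A double advance could only pass the other pawn by jumping over a square that
   must be empty. *)
case/orP: Hadv => [/eqP Hd1|/andP[/andP[/eqP Hs1 /eqP Hd3] /forallP/(_ s)]].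
  by move: Hle Hd1; rewrite /rel_rank; case: (color_of q) => /=; lia.
rewrite Hs implybF /between Nd andbT /dfile /drank Hf -Hfd /dist !subnn /=.
rewrite mul0n muln0 eqxx andbT.
move=> Hb; apply: contraNT Hb; rewrite -ltnNge => Hgt.
rewrite andbT; apply/andP; split.
  apply/eqP=> E; move: Hle Hgt Hs1 Hd3; rewrite E /rel_rank.
  by case: (color_of q) => /=; lia.
by apply/eqP; move: Hle Hgt Hs1 Hd3 Nr; rewrite /rel_rank;
  case: (color_of q) => /=; lia.
Qed.

Lemma pawn_moves_in_rcons l y o : pawn_moves_in (rcons l y) o =
  if moved_by o y && pawn_move y.1 y.2 then rcons (pawn_moves_in l o) y
  else pawn_moves_in l o.
Proof. exact: filter_rcons. Qed.

Lemma advance_rcons l y o : advance (rcons l y) o =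
  advance l o + (if moved_by o y && pawn_move y.1 y.2
                 then drank (src y.2) (dst y.2) else 0).
Proof.
rewrite /advance /steps pawn_moves_in_rcons; case: ifP => _; last by rewrite addn0.
by rewrite map_rcons sumn_rcons.
Qed.

Lemma pair_resolved_rcons l y i : ~~ pair_resolved (rcons l y) i ->
  ~~ pair_resolved l i /\ forall c, moved_by (pawn_home c i) y -> ~~ pawn_capture y.
Proof.
move=> H; split=> [|c Hc]; apply: contraNN H.
  by case/existsP=> c Hc; apply/existsP; exists c; rewrite has_rcons Hc orbT.
by move=> Hy; apply/existsP; exists c; rewrite has_rcons Hc Hy.
Qed.

Lemma scanl_add_rcons s d x :
  scanl addn x (rcons s d) = rcons (scanl addn x s) (x + sumn s + d).
Proof. by elim: s x => [|e s IH] x /=; rewrite ?addn0 // IH addnA. Qed.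

Section Step.

Variables (l : seq ply) (p : position) (m : move).
Hypotheses (Hh : history l p) (Hl : legal p m).

Let Hco := now_coherent Hh.
Let l' := rcons l (p, m).

Lemma moved_pawn o : moved_by o (p, m) -> pawn_move p m ->
  exists q, [/\ mover p m = Some q, kind_of q = Pawn & origin q = o].
Proof.
rewrite /moved_by /pawn_move /=; case: (mover p m) => [q|] //= /eqP[<-] /eqP Hk.
by exists q.
Qed.

Lemma mover_advance q : mover p m = Some q -> kind_of q = Pawn ->
  (advance l' (origin q)).+1 = rel_rank (color_of q) (dst m).
Proof.
move=> Hq Hk; have [Hr _ _ _] := legal_pawn_move Hl Hq Hk.
rewrite Hr -(pawn_rank Hh Hq Hk).1 advance_rcons /moved_by /pawn_move /= Hq Hk.
by rewrite /= !eqxx addSn.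
Qed.

Lemma other_advance s q : pieces p s = Some q -> kind_of q = Pawn ->
  s != src m -> advance l' (origin q) = advance l (origin q).
Proof.
move=> Hq Hk Ns; rewrite advance_rcons; case: ifP => [/andP[H1 H2]|_]; last exact: addn0.
have [q' [Hq' Hk' Ho]] := moved_pawn H1 H2.
by rewrite (pawn_unique Hco Hq Hq' Hk Hk') ?eqxx // in Ns.
Qed.

Lemma step_pawn_rank s q : next_board p m s = Some q -> kind_of q = Pawn ->
  (advance l' (origin q)).+1 = rel_rank (color_of q) s /\
  rel_rank (color_of q) s <= 6.
Proof.
move=> /(pawn_after Hl) H Hk; have [[-> Hn Hq]|[_ Ns Hq]] := H Hk.
  split; first exact: mover_advance.
  have [_ _ Hp _] := legal_pawn_move Hl Hq Hk.
  move: Hp; rewrite Hn /= => Hp.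
  have : rel_rank (color_of q) (dst m) <= 7.
    by rewrite /rel_rank; have := ltn_ord (rank (dst m)); case: (color_of q); lia.
  by rewrite leq_eqVlt -Hp.
by rewrite (other_advance Hq Hk Ns); apply: (pawn_rank Hh).
Qed.

Lemma step_advance_le6 o : advance l' o <= 6.
Proof.
have := advance_rcons l (p, m) o; case: ifP => [/andP[H1 H2] _|_ ->]; last first.
  by rewrite addn0 (advance_le6 Hh).
have [q [Hq Hk <-]] := moved_pawn H1 H2.
rewrite -ltnS (mover_advance Hq Hk) /rel_rank.
by have := ltn_ord (rank (dst m)); case: (color_of q); lia.
Qed.

Lemma step_steps_gt0 o : all (leq 1) (steps l' o).
Proof.
rewrite /steps pawn_moves_in_rcons.
case: ifP => [/andP[H1 H2]|_]; last exact: steps_gt0 Hh o.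
have [q [Hq Hk Ho]] := moved_pawn H1 H2.
have [_ Hgt _ _] := legal_pawn_move Hl Hq Hk.
by rewrite map_rcons all_rcons Hgt; apply: steps_gt0 Hh o.
Qed.

Lemma step_promotes_at6 o : [seq promotes y | y <- pawn_moves_in l' o]
  = [seq d == 6 | d <- scanl addn 0 (steps l' o)].
Proof.
have Ha := advance_rcons l (p, m) o.
rewrite /steps pawn_moves_in_rcons; move: Ha.
case: ifP => [/andP[H1 H2]|_] Ha; last exact: promotes_at6 Hh o.
have [q [Hq Hk Ho]] := moved_pawn H1 H2.
have [_ _ Hp _] := legal_pawn_move Hl Hq Hk.
rewrite !map_rcons scanl_add_rcons map_rcons (promotes_at6 Hh); congr rcons.
rewrite /promotes Hp -(mover_advance Hq Hk) Ho Ha /= eqSS.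
by rewrite add0n.
Qed.

Lemma step_unresolved_file s q : next_board p m s = Some q -> kind_of q = Pawn ->
  ~~ pair_resolved l' (file (origin q)) -> file s = file (origin q).
Proof.
move=> /(pawn_after Hl) H Hk /pair_resolved_rcons[Hu Hn].
have [[-> _ Hq]|[_ _ Hq]] := H Hk; last exact: (unresolved_file Hh) Hq Hk Hu.
rewrite -(unresolved_file Hh Hq Hk Hu).
have Hm : moved_by (pawn_home (color_of q) (file (origin q))) (p, m).
  by rewrite /moved_by /= Hq /= -(pawn_origin Hco Hq Hk).
have := Hn _ Hm; rewrite /pawn_capture /pawn_move /= Hq Hk eqxx /= => Nc.
have [_ _ _ [|]] := legal_pawn_move Hl Hq Hk; last by rewrite (negbTE Nc).
by case/andP=> /andP[/eqP ->].
Qed.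

Lemma step_no_pawn o :
  (forall s q, pieces p s = Some q -> kind_of q = Pawn -> origin q <> o) ->
  forall s q, next_board p m s = Some q -> kind_of q = Pawn -> origin q <> o.
Proof.
move=> Hd s q /(pawn_after Hl) H Hk.
by have [[_ _ Hq]|[_ _ Hq]] := H Hk; apply: Hd Hq Hk.
Qed.

(** When a pawn of the pair moves without capturing, either the other one is
    still a pawn on the board, and they go on facing each other, or it is gone,
    and its advance remains at most 4 for ever. *)
Lemma step_unresolved_pair i : ~~ pair_resolved l' i ->
  advance l' (pawn_home White i) + advance l' (pawn_home Black i) <= 4 \/
  exists c, advance l' (pawn_home c i) <= 4 /\
    forall s q, next_board p m s = Some q -> kind_of q = Pawn ->
      origin q <> pawn_home c i.
Proof.
case/pair_resolved_rcons=> Hu Hn.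
have Hold := unresolved_pair Hh Hu.
have dead_step c : (forall s q, pieces p s = Some q -> kind_of q = Pawn ->
      origin q <> pawn_home c i) ->
    advance l' (pawn_home c i) = advance l (pawn_home c i).
  move=> Hd; rewrite advance_rcons; case: ifP => [/andP[H1 H2]|_]; last exact: addn0.
  by have [q [Hq Hk /(Hd _ _ Hq Hk)]] := moved_pawn H1 H2.
case: Hold => [Hsum|[c [Hc Hd]]]; last first.
  by right; exists c; rewrite dead_step //; split=> //; apply: step_no_pawn.
have [c /andP[H1 H2]|Hno] :=
    pickP (fun c => moved_by (pawn_home c i) (p, m) && pawn_move p m); last first.
  by left; rewrite !advance_rcons /= !Hno !addn0.
have [q [Hq Hk Ho]] := moved_pawn H1 H2.
have /pawn_home_inj[Hcq Hi] : pawn_home (color_of q) (file (origin q)) = pawn_home c i.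
  by rewrite -(pawn_origin Hco Hq Hk).
have Nc : ~~ capture p m.
  by have := Hn _ H1; rewrite /pawn_capture /= H2.
have Hsum' : advance l (pawn_home c i) + advance l (pawn_home (opponent c) i) <= 4.
  by case: (c) => //=; rewrite addnC.
(* Is the opposing pawn still a pawn on the board? *)
have [s Hs|Hdead] := pickP (fun s => if pieces p s is Some q' then
    (kind_of q' == Pawn) && (origin q' == pawn_home (opponent c) i)
  else false); last first.
  have Hd s q' : pieces p s = Some q' -> kind_of q' = Pawn ->
      origin q' <> pawn_home (opponent c) i.
    by move=> E Hk' Ho'; have := Hdead s; rewrite E Hk' Ho' !eqxx.
  right; exists (opponent c); rewrite dead_step //; split; last exact: step_no_pawn.
  exact: leq_trans (leq_addl _ _) Hsum'.
case Es : (pieces p s) Hs => [q'|] // /andP[/eqP Hk' /eqP Ho'].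
have /pawn_home_inj[Hcq' Hi'] :
    pawn_home (color_of q') (file (origin q')) = pawn_home (opponent c) i.
  by rewrite -(pawn_origin Hco Es Hk').
have Ns : s != src m.
  apply/eqP=> E; move: Es; rewrite E -/(mover p m) Hq => -[E'].
  by move: Hcq'; rewrite -E' Hcq; case: (c).
have Hfile : file s = file (src m).
  by rewrite (unresolved_file Hh Es Hk') ?(unresolved_file Hh Hq Hk) ?Hi ?Hi'.
have [Hr _] := pawn_rank Hh Hq Hk; have [Hr' _] := pawn_rank Hh Es Hk'.
have := @facing_pawns p m q s Hl Hq Hk Nc; rewrite Es => /(_ isT Hfile).
rewrite Hcq in Hr *; rewrite Hcq' in Hr'.
have := mover_advance Hq Hk; rewrite Hcq => <-.
rewrite -Hr -Hr' -(other_advance Es Hk' Ns) !addSn !addnS Ho Ho' => Hfacing.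
left; suff: advance l' (pawn_home c i) + advance l' (pawn_home (opponent c) i) <= 4.
  by case: (c) => //=; rewrite addnC.
apply: Hfacing; rewrite -Ho' (other_advance Es Hk' Ns) Ho'.
exact: Hsum'.
Qed.

Lemma step_attributed : attributed (p, m).
Proof.
apply/implyP=> /=; rewrite /pawn_move; case Hq: (mover p m) => [q|//] /eqP Hk.
apply/existsP; exists (color_of q); apply/existsP; exists (file (origin q)).
by rewrite /moved_by /= Hq /= -(pawn_origin Hco Hq Hk).
Qed.

Lemma history_step : history l' (make_move p m).
Proof.
split.
- exact: coherent_make_move.
- exact: step_pawn_rank.
- exact: step_advance_le6.
- exact: step_steps_gt0.
- exact: step_promotes_at6.
- exact: step_unresolved_file.
- exact: step_unresolved_pair.
- by rewrite all_rcons step_attributed (all_attributed Hh).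
- rewrite /l' -cats1 count_cat /= addn0 addnCA.
  apply: leq_trans _ (men_left Hh); rewrite [leqRHS]addnC leq_add2l.
  exact: occupied_make_move.
- by move=> _; rewrite /= opponentK; case/andP: Hl.
Qed.

End Step.

Lemma history_line l p ms : history l p -> legal_line p ms ->
  history (l ++ plies_from p ms) (play p ms).
Proof.
elim: ms l p => [|m ms IH] l p Hh /=; first by rewrite cats0.
by case/andP=> Hl Hms; rewrite -cat_rcons; apply: IH => //; apply: history_step.
Qed.

Lemma history_game g : legal_line initial g -> history (plies g) (play initial g).
Proof. exact: (history_line history_initial). Qed.

(** * Thirty captures end the game *)

Lemma two_kings p : coherent p -> exists sW sB,
  [/\ [set sW; sB] \subset occupied p, #|[set sW; sB]| = 2,
      holds (pieces p) sW White King & holds (pieces p) sB Black King].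
Proof.
move=> Hco; have [sW HW] := king_alive Hco White; have [sB HB] := king_alive Hco Black.
exists sW, sB; split=> //.
  apply/subsetP=> s; rewrite !inE; case/orP=> /eqP ->.
    by case/holdsP: HW => q [->].
  by case/holdsP: HB => q [->].
rewrite cards2; suff -> : sW != sB by [].
apply: contraTneq HW => ->; apply/holdsP=> -[q [E Hc _]].
by case/holdsP: HB => q' [E' Hc' _]; move: E Hc'; rewrite E' => -[->]; rewrite Hc.
Qed.

Lemma captures_le30 l p : history l p -> count (fun y => capture y.1 y.2) l <= 30.
Proof.
move=> Hh; have [sW [sB [Hsub H2 _ _]]] := two_kings (now_coherent Hh).
have := men_left Hh; have := subset_leq_card Hsub; rewrite H2.
by move: #|occupied p| => n; lia.
Qed.

Lemma king_attack_sym b b' q q' s s' : kind_of q = King -> kind_of q' = King ->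
  attacks b q s s' -> attacks b' q' s' s.
Proof.
have distC a c : dist a c = dist c a by rewrite /dist addnC.
rewrite /attacks => -> ->.
by rewrite eq_sym /dfile distC /drank (distC (rank s)).
Qed.

(** Bare kings check each other simultaneously, so that a check would be one
    into which the last mover has moved. *)
Lemma bare_kings_no_checkmate l p : history l p ->
  30 <= count (fun y => capture y.1 y.2) l -> ~ checkmate p.
Proof.
move=> Hh H30 /andP[Hchk _].
have [sW [sB [Hsub H2 HW HB]]] := two_kings (now_coherent Hh).
have Hocc : occupied p = [set sW; sB].
  apply/esym/eqP; rewrite eqEcard Hsub H2.
  by have := men_left Hh; move: #|occupied p| => n; lia.
have Hking s q : pieces p s = Some q -> kind_of q = King.
  move=> E; have : s \in occupied p by rewrite inE E.
  rewrite Hocc !inE => /orP[] /eqP Es; move: E; rewrite Es.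
    by case/holdsP: HW => q' [-> _ <-] [->].
  by case/holdsP: HB => q' [-> _ <-] [->].
have Hne : l <> [::] by move=> E; rewrite E in H30.
move/negP: (last_mover_safe Hh Hne); apply.
case/existsP: Hchk => s /andP[/holdsP[q [Eq Hc Hk]] /existsP[s']].
case Eq': (pieces p s') => [q'|] // /andP[/eqP Hc' Hat].
apply/existsP; exists s'; apply/andP; split.
  by apply/holdsP; exists q'; rewrite Eq' Hc' (Hking _ _ Eq').
apply/existsP; exists s; rewrite Eq Hc opponentK eqxx /=.
exact: king_attack_sym (Hking _ _ Eq') Hk Hat.
Qed.

Lemma bare_kings_dead l p : history l p ->
  30 <= count (fun y => capture y.1 y.2) l -> dead p.
Proof.
move=> Hh H30 [ms [Hms]]; apply: (bare_kings_no_checkmate (history_line Hh Hms)).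
by rewrite count_cat (leq_trans H30) ?leq_addr.
Qed.

(** * Segments *)

Lemma size_plies_from p g : size (plies_from p g) = size g.
Proof. by elim: g p => //= m g IH p; rewrite IH. Qed.

Lemma plies_from_take p g k : plies_from p (take k g) = take k (plies_from p g).
Proof. by elim: g p k => [|m g IH] p [|k] //=; rewrite IH. Qed.

Lemma size_critical_plies g : size (critical_plies g) = count critical (plies g).
Proof.
rewrite size_filter /critical_at -(size_plies_from initial g) -/(plies g).
rewrite -(size_map critical) -[RHS](count_map critical id).
set s := map critical _; rewrite (iotaDl 1 0) count_map.
rewrite -[in RHS](mkseq_nth false s) /mkseq count_map.
exact: eq_count.
Qed.

Lemma le_last_critical g u : 0 < u <= size g -> critical_at g u ->
  u <= last 0 (critical_plies g).
Proof.
move=> Hu Hc; set s := critical_plies g.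
have Hin : u \in s by rewrite mem_filter Hc mem_iota add1n ltnS.
have Hs : sorted leq s.
  by apply: sorted_filter; [exact: leq_trans | exact: iota_sorted].
have Hidx : index u s < size s by rewrite index_mem.
rewrite -{1}(nth_index 0 Hin) -nth_last.
apply: (sorted_leq_nth leq_trans leqnn) => //.
- by rewrite inE; case: (size s) Hidx.
- by case: (size s) Hidx.
Qed.

Lemma capture_count_critical l :
  ~~ has critical l -> count (fun y => capture y.1 y.2) l = 0.
Proof.
move=> H; apply/eqP; rewrite -leqn0 leqNgt -has_count; apply: contraNN H.
by apply: sub_has => y; rewrite /critical => ->; rewrite orbT.
Qed.

(** The thirtieth capture ends the game, so that no ply follows it. *)
Lemma captures_tail_le30 g : is_game g -> num_captures g + num_tail g <= 30.
Proof.
move=> [Hline Hgo _]; have Hh := history_game Hline.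
have C30 := captures_le30 Hh; rewrite /num_captures /num_tail.
case Ht : (has_tail g); last by rewrite addn0.
rewrite addn1 ltnNge; apply/negP=> H30.
have Hcrit : critical_plies g <> [::].
  move/(congr1 size); rewrite size_critical_plies => /eqP.
  rewrite -leqn0 leqNgt -has_count => /capture_count_critical E.
  by rewrite E in H30.
move: Ht; rewrite /has_tail; case: eqP => //= _.
set t := last 0 _ => /hasP[u]; rewrite mem_iota => /andP[tu us] _.
have Htg : t < size g by lia.
(* The game should already have ended after its last critical ply [t], by which
   all the captures have been made. *)
apply: (Hgo t Htg); right; right; left.
have Hline' : legal_line initial (take t g).
  elim: (g) (initial) (t) Hline => [|m g' IH] p [|k] //=.
  by case/andP=> -> /IH ->.
apply: bare_kings_dead (history_game Hline') _.
rewrite /plies plies_from_take -/(plies g).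
suff Z : count (fun y => capture y.1 y.2) (drop t (plies g)) = 0.
  by move: H30; rewrite -{1}(cat_take_drop t (plies g)) count_cat Z addn0.
apply: capture_count_critical; apply/negP=> Hd.
have Hi := Hd; rewrite has_find in Hi; set i := find _ _ in Hi.
pose y0 : ply := (initial, (king_home White, king_home White, None)).
have Hn : critical (nth y0 (drop t (plies g)) i) by apply: nth_find.
rewrite size_drop size_plies_from in Hi; rewrite nth_drop in Hn.
suff : (t + i).+1 <= t by lia.
apply: le_last_critical; first by lia.
rewrite /critical_at -[(t + i).+1.-1]/(t + i) (nth_map y0) //.
by rewrite size_plies_from; lia.
Qed.

(** * Counting by files *)

(** Each pawn move is made by exactly one of the sixteen pawns. *)
Lemma count_by_file (a : pred ply) l : all attributed l ->
  (forall y, a y -> pawn_move y.1 y.2) ->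
  count a l = \sum_(i < 8) (count (fun y => moved_by (pawn_home White i) y && a y) l
                           + count (fun y => moved_by (pawn_home Black i) y && a y) l).
Proof.
move=> + Ha; elim: l => [_|y l IH /= /andP[Hy /IH ->]]; first by rewrite big1.
rewrite [RHS](eq_bigr _ (fun i _ => addnACA _ _ _ _)) [RHS]big_split /=.
congr addn.
case Hay : (a y); last by rewrite big1 // => i _; rewrite !andbF.
move: Hy; rewrite /attributed (Ha _ Hay) /= => /existsP[c /existsP[i Hi]].
have uniq_mover c' j : moved_by (pawn_home c' j) y = (c' == c) && (j == i).
  move: Hi; rewrite /moved_by => /eqP ->; apply/eqP/andP => [E|[/eqP -> /eqP -> //]].
  by have [-> ->] := pawn_home_inj (Some_inj E).
rewrite (bigD1 i) //= big1 => [|j /negbTE Nj]; rewrite !uniq_mover.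
  by rewrite eqxx; case: (c).
by rewrite Nj !andbF.
Qed.

Lemma size_le_sumn s : all (leq 1) s -> size s <= sumn s.
Proof. by elim: s => //= d s IH /andP[Hd /IH]; lia. Qed.

Lemma sumn_le_size s : all (leq 1) s -> sumn s <= size s -> s = nseq (size s) 1.
Proof.
elim: s => //= d s IH /andP[Hd Hs] Hle; have := size_le_sumn Hs => Hle'.
by have <- := IH Hs; [congr cons; lia | lia].
Qed.

Section Files.

Variables (l : seq ply) (p : position).
Hypothesis Hh : history l p.

Lemma pawn_moves_le_advance o : size (pawn_moves_in l o) <= advance l o.
Proof.
have <- : size (steps l o) = size (pawn_moves_in l o) by rewrite size_map.
exact: size_le_sumn (steps_gt0 Hh o).
Qed.

Lemma pawn_moves_le6 o : size (pawn_moves_in l o) <= 6.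
Proof. exact: leq_trans (pawn_moves_le_advance o) (advance_le6 Hh o). Qed.

(** A member of an unresolved pair can get past the other only after the other
    has been captured, at most four ranks from its home. *)
Lemma pair_moves_bound i :
  size (pawn_moves_in l (pawn_home White i)) + size (pawn_moves_in l (pawn_home Black i))
  <= 10 + 2 * pair_resolved l i.
Proof.
have W6 := pawn_moves_le6 (pawn_home White i).
have B6 := pawn_moves_le6 (pawn_home Black i).
case Hr : (pair_resolved l i) => /=; first by lia.
have Wa := pawn_moves_le_advance (pawn_home White i).
have Ba := pawn_moves_le_advance (pawn_home Black i).
have [|[c [Hc _]]] := unresolved_pair Hh (negbT Hr); first by lia.
by case: c Hc; lia.
Qed.

Lemma pair_resolved_captures i : pair_resolved l i <=
  count (fun y => moved_by (pawn_home White i) y && pawn_capture y) l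
  + count (fun y => moved_by (pawn_home Black i) y && pawn_capture y) l.
Proof.
case Hr : (pair_resolved l i) => //=.
by case/existsP: Hr => -[]; rewrite has_count; lia.
Qed.

Lemma six_moves_promote o : size (pawn_moves_in l o) = 6 ->
  all one_rank (pawn_moves_in l o) /\
  [seq promotes y | y <- pawn_moves_in l o]
  = [:: false; false; false; false; false; true].
Proof.
move=> H6; have Hs : steps l o = nseq 6 1.
  have S6 : size (steps l o) = 6 by rewrite size_map.
  by have := sumn_le_size (steps_gt0 Hh o); rewrite S6; apply; apply: advance_le6 Hh o.
split; last by rewrite (promotes_at6 Hh) Hs.
have : all (eq_op^~ 1) (steps l o) by rewrite Hs.
by rewrite all_map.
Qed.

End Files.

Theorem theorem3p7 (g : seq move) (hg : is_game g) :
  num_segments g <= 118 /\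
  (num_segments g = 118 ->
     [/\ num_resolved g = 8,
         num_pawn_moves g = 96,
         num_pawn_captures g = 8
       & num_captures g + num_tail g = 30]
     /\ (forall (c : color) (i : 'I_8), six_steps_to_promotion g (pawn_home c i))
     /\ 29 <= num_captures g).
Proof.
have CT := captures_tail_le30 hg; have [Hline _ _] := hg.
have Hh := history_game Hline; have Hatt := all_attributed Hh.
pose n c i := size (pawn_moves_in (plies g) (pawn_home c i)).
have Pn : num_pawn_moves g = \sum_(i < 8) (n White i + n Black i).
  rewrite /num_pawn_moves (count_by_file Hatt) //.
  by apply: eq_bigr => i _; rewrite /n !size_filter.
have fE : num_resolved g = \sum_(i < 8) pair_resolved (plies g) i.
  rewrite /num_resolved -sum1dep_card big_mkcond; apply: eq_bigr => i _.
  by rewrite -[pair_resolved _ _]/(resolved g i); case: (resolved g i).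
have Pf : num_pawn_moves g <= 80 + 2 * num_resolved g.
  have -> : 80 + 2 * num_resolved g = \sum_(i < 8) (10 + 2 * pair_resolved (plies g) i).
    by rewrite big_split /= -big_distrr /= -fE sum_nat_const card_ord.
  by rewrite Pn; apply: leq_sum => i _; apply: (pair_moves_bound Hh).
have fC : num_resolved g <= num_pawn_captures g.
  rewrite fE /num_pawn_captures (count_by_file Hatt); last by move=> y /andP[].
  by apply: leq_sum => i _; apply: pair_resolved_captures.
have f8 : num_resolved g <= 8 by rewrite /num_resolved (leq_trans (max_card _)) ?card_ord.
have KE : num_segments g + num_pawn_captures g
    = num_pawn_moves g + (num_captures g + num_tail g).
  rewrite /num_segments size_critical_plies addnA /num_pawn_moves /num_captures.
  by rewrite -count_predUI addnAC.
split; first by lia.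
move=> K118; have P96 : num_pawn_moves g = 96 by lia.
split; first by split; lia.
split; last by move: CT K118 KE; rewrite /num_tail; case: (has_tail g) => /=; lia.
move=> c i.
have n6 : n c i = 6.
  have n_le6 c' j : n c' j <= 6 by apply: (pawn_moves_le6 Hh).
  (* The other seven files contribute at most 12 moves each, so this one must
   contribute 12. *)
have rest : \sum_(j < 8 | j != i) (n White j + n Black j) <= 84.
    have -> : 84 = \sum_(j < 8 | j != i) 12.
      by rewrite sum_nat_const cardC1 card_ord.
    by apply: leq_sum => j _; apply: (@leq_add _ _ 6 6).
  move: P96 rest; rewrite Pn (bigD1 i) //=; move: (\sum_(j < 8 | _) _) => r.
  have := n_le6 White i; have := n_le6 Black i; rewrite /n; case: c; lia.
by have [H1 H2] := six_moves_promote Hh n6.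
Qed.
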